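(* Let $n\ge d\ge 1$ be integers and let $f=(f_1,\dots,f_n)^\top:\mathbb{R}^d\to\mathbb{R}^n$ be differentiable with Jacobian $J$. Assume: (i) there is $L_f>0$ with $\|f(x)-f(y)\|\le L_f\|x-y\|$ for all $x,y\in\mathbb{R}^d$; (ii) there are $\nu\in(0,1]$ and $\mathcal{H}_\nu>0$ with $\|J(x)-J(y)\|\le \mathcal{H}_\nu\|x-y\|^\nu$ for all $x,y\in\mathbb{R}^d$; (iii) $x^*\in\mathbb{R}^d$ satisfies $f(x^* )=0$ and $\mu=\sigma_{\min}(J(x^* ))>0$. Run the MB-IGN algorithm (described in the context) with mini-batch size $k\in\{1,\dots,n\}$ from $x^0\in\mathbb{R}^d$ with $H^0=J(x^0)^\top J(x^0)$ and $G^0=(H^0)^{-1}$, where $$\|x^0-x^*\|\le\left(\frac{\mu^2}{4kL_f\mathcal{H}_\nu \lceil n/k\rceil}\right)^{1/\nu}.$$ Then $H^t\succeq(\mu^2/2)I$ and $\sigma_{\min}(I+(V^t)^\top G^tU^t)>0$ for all $t\ge0$. Additionally, there exists a sequence $\{r_t\}_{t\ge 0}$ such that $\|x^t-x^*\|\le r_t$ and $$r_{t+1}\le c^{(1+\nu)^{\left\lfloor \frac{t}{\lceil n/k\rceil}\right\rfloor-1}}\,r_t\quad\text{for all } t\ge \lceil n/k\rceil,\qquad\text{where } c=1-\frac{1}{\lceil n/k\rceil}\left(1-\left(\frac{1}{2(1+\nu)}\right)^{1+\nu}\right).$$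
   Context: $\|\cdot\|$ is the Euclidean norm for vectors and the spectral norm for matrices; $\sigma_{\min}$ is the smallest singular value; $I$ is an identity matrix; $\succeq$ is the Loewner order on symmetric matrices. For $f=(f_1,\dots,f_n)^\top$, $g_j(x)=\nabla f_j(x)\in\mathbb{R}^d$ and $J(x)=[g_1(x),\dots,g_n(x)]^\top\in\mathbb{R}^{n\times d}$. MB-IGN algorithm with mini-batch size $k$. Let $m=\lceil n/k\rceil$ and let $\{S_1,\dots,S_m\}$ be a partition of $\{1,\dots,n\}$ into disjoint subsets with $|S_1|=\dots=|S_{m-1}|=k$ (so $|S_m|\le k$). Initialize with $x^0\in\mathbb{R}^d$, $z_i^0=x^0$ for $i=1,\dots,m$, $u^0=\sum_{i=1}^m\sum_{j\in S_i}\big(g_j(z_i^0)^\top z_i^0-f_j(z_i^0)\big)g_j(z_i^0)$, $H^0=J(x^0)^\top J(x^0)$, $G^0=(H^0)^{-1}$. For $t=0,1,2,\dots$, with $i_t=(t\bmod m)+1$ and $S_{i_t}=\{j_1,\dots,j_s\}$, $s=|S_{i_t}|$: - $x^{t+1}=G^tu^t$; - $U^t=[-g_{j_1}(z_{i_t}^t),\ g_{j_1}(x^{t+1}),\ \dots,\ -g_{j_s}(z_{i_t}^t),\ g_{j_s}(x^{t+1})]$ and $V^t=[g_{j_1}(z_{i_t}^t),\ g_{j_1}(x^{t+1}),\ \dots,\ g_{j_s}(z_{i_t}^t),\ g_{j_s}(x^{t+1})]$, both in $\mathbb{R}^{d\times 2s}$; - $u^{t+1}=u^t-\sum_{j\in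 S_{i_t}}\big(g_j(z_{i_t}^t)^\top z_{i_t}^t-f_j(z_{i_t}^t)\big)g_j(z_{i_t}^t)+\sum_{j\in S_{i_t}}\big(g_j(x^{t+1})^\top x^{t+1}-f_j(x^{t+1})\big)g_j(x^{t+1})$; - $H^{t+1}=H^t-\sum_{j\in S_{i_t}}g_j(z_{i_t}^t)g_j(z_{i_t}^t)^\top+\sum_{j\in S_{i_t}}g_j(x^{t+1})g_j(x^{t+1})^\top$; - $G^{t+1}=G^t-G^tU^t\big(I+(V^t)^\top G^tU^t\big)^{-1}(V^t)^\top G^t$; - $z_i^{t+1}=x^{t+1}$ if $i=i_t$, and $z_i^{t+1}=z_i^t$ otherwise. *)

(* Defs.v *)
From HB Require Import structures.
From mathcomp Require Import all_boot all_order all_algebra.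
From mathcomp Require Import all_classical all_reals all_analysis.
Set Implicit Arguments.
Unset Strict Implicit.
Unset Printing Implicit Defensive.
Import Order.TTheory GRing.Theory Num.Theory.
Import numFieldNormedType.Exports.

Local Open Scope ring_scope.

(* The library norm on matrices is the max norm; it induces the same notions of
   derivative and differentiability, but not the estimates below. *)
Definition enorm (R : realType) (p : nat) (v : 'cV[R]_p) : R :=
  Num.sqrt (\sum_i v i 0 ^+ 2).

Definition spectral_norm (R : realType) (p q : nat) (A : 'M[R]_(p, q)) : R :=
  sup [set enorm (A *m v) | v in [set v : 'cV[R]_q | enorm v <= 1]]%classic.

(* s is a singular value of A, with left and right singular vectors a and b.
   For a p x q matrix this yields exactly the min(p, q) singular values: 0 is
   one of them iff both kernels are nontrivial, i.e., iff \rank A < min(p, q). *)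
Definition singular_value (R : realType) (p q : nat) (A : 'M[R]_(p, q))
    (s : R) : Prop :=
  0 <= s /\ exists (a : 'cV[R]_p) (b : 'cV[R]_q),
    [/\ enorm a = 1, enorm b = 1, A *m b = s *: a & A^T *m a = s *: b].

(* The infimum is a minimum as soon as p, q > 0. *)
Definition sigma_min (R : realType) (p q : nat) (A : 'M[R]_(p, q)) : R :=
  inf [set s : R | singular_value A s]%classic.

Definition loewner_ge (R : realType) (p : nat) (A B : 'M[R]_p) : Prop :=
  [/\ A^T = A, B^T = B &
      forall v : 'cV[R]_p, 0 <= (v^T *m (A - B) *m v) 0 0].

Section MBIGN.
Context {R : realType} {d n : nat}.
Variable f : 'cV[R]_d -> 'cV[R]_n.

(* gradient of the component f_j *)
Definition grad (j : 'I_n) (x : 'cV[R]_d) : 'cV[R]_d :=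
  \col_a 'D_(delta_mx a 0) (fun y : 'cV[R]_d => f y j 0) x.

Definition jac (x : 'cV[R]_d) : 'M[R]_(n, d) := \matrix_(j, a) grad j x a 0.

Definition uterm (j : 'I_n) (y : 'cV[R]_d) : 'cV[R]_d :=
  (((grad j y)^T *m y) 0 0 - f y j 0) *: grad j y.

Definition Hterm (j : 'I_n) (y : 'cV[R]_d) : 'M[R]_d :=
  grad j y *m (grad j y)^T.

(* ceiling of n / k, for k > 0 *)
Definition nbatch (n k : nat) : nat := ((n + k.-1) %/ k)%N.

(* Batches are numbered from 0: the blocks are S 0, ..., S (m - 1) with
   m = nbatch n k, and the values of S beyond m are never used.  The last block
   then consists of the n - (m - 1) k remaining indices. *)
Definition batch_partition (k : nat) (S : nat -> {set 'I_n}) : Prop :=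
  [/\ forall j : 'I_n, exists2 i, (i < nbatch n k)%N & j \in S i,
      forall i i', (i < nbatch n k)%N -> (i' < nbatch n k)%N -> i != i' ->
        [disjoint S i & S i'] &
      forall i, (i.+1 < nbatch n k)%N -> #|S i| = k].

(* With B = {j_1, ..., j_s} enumerated by enum_val, y the old anchor of the
   block and y' the new iterate, the l-th pair of columns is
   -g_{j_l}(y), g_{j_l}(y') in Ublock and g_{j_l}(y), g_{j_l}(y') in Vblock. *)
Definition Ublock (B : {set 'I_n}) (y y' : 'cV[R]_d) :
    'M[R]_(d, \sum_(l < #|B|) 2) :=
  \mxrow_(l < #|B|) row_mx (- grad (enum_val l) y) (grad (enum_val l) y').

Definition Vblock (B : {set 'I_n}) (y y' : 'cV[R]_d) :
    'M[R]_(d, \sum_(l < #|B|) 2) :=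
  \mxrow_(l < #|B|) row_mx (grad (enum_val l) y) (grad (enum_val l) y').

Record ign_state := IgnState {
  st_x : 'cV[R]_d;
  st_z : nat -> 'cV[R]_d;
  st_u : 'cV[R]_d;
  st_H : 'M[R]_d;
  st_G : 'M[R]_d }.

Variables (k : nat) (S : nat -> {set 'I_n}) (x0 : 'cV[R]_d).
Let m := nbatch n k.

Definition ign_init : ign_state :=
  let H0 := (jac x0)^T *m jac x0 in
  {| st_x := x0;
     st_z := fun=> x0;
     st_u := \sum_(i < m) \sum_(j in S i) uterm j x0;
     st_H := H0;
     st_G := invmx H0 |}.

Definition ign_batch (t : nat) : {set 'I_n} := S (t %% m)%N.

Definition next_x (s : ign_state) : 'cV[R]_d := st_G s *m st_u s.

Definition ign_U (t : nat) (s : ign_state) :=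
  Ublock (ign_batch t) (st_z s (t %% m)%N) (next_x s).

Definition ign_V (t : nat) (s : ign_state) :=
  Vblock (ign_batch t) (st_z s (t %% m)%N) (next_x s).

Definition ign_core (t : nat) (s : ign_state) :=
  1%:M + (ign_V t s)^T *m st_G s *m ign_U t s.

Definition ign_step (t : nat) (s : ign_state) : ign_state :=
  let: IgnState _ z u H G := s in
  let B := ign_batch t in
  let y := z (t %% m)%N in
  let x := next_x s in
  {| st_x := x;
     st_z := fun i => if i == (t %% m)%N then x else z i;
     st_u := u - \sum_(j in B) uterm j y + \sum_(j in B) uterm j x;
     st_H := H - \sum_(j in B) Hterm j y + \sum_(j in B) Hterm j x;
     st_G := G - G *m ign_U t s *m invmx (ign_core t s)
                   *m (ign_V t s)^T *m G |}.

Fixpoint mb_ign (t : nat) : ign_state :=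
  if t is t'.+1 then ign_step t' (mb_ign t') else ign_init.

End MBIGN.

(* Main.v *)
Require Import Defs.
From HB Require Import structures.
From mathcomp Require Import all_boot all_order all_algebra.
From mathcomp Require Import all_classical all_reals all_analysis.
From mathcomp Require Import ring lra zify.
Set Implicit Arguments.
Unset Strict Implicit.
Unset Printing Implicit Defensive.
Import Order.TTheory GRing.Theory Num.Theory.
Import numFieldNormedType.Exports.
Local Open Scope ring_scope.

(* With the anchors z_i of the blocks i, the error satisfies
     H^t (x^(t+1) - xs) = sum_i J_i(z_i)^T e_i,
   where e_i is the Taylor remainder of f_i at z_i, evaluated at xs.  Hoelder
   continuity of J bounds e_i by a multiple of |z_i - xs|^(1+nu), and it also
   keeps H^t >= mu^2/2 as long as all anchors stay in the initial ball, so
     |x^(t+1) - xs| <= a * sum_i |z_i - xs|^(1+nu).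
   The anchors are the last m iterates, hence r may be taken as the solution of
   the delayed recurrence r_(t+1) = a * sum_(s < m) r_(t-s)^(1+nu) with constant
   history.  A ratio bound r_(t+1) <= C r_t valid over one epoch becomes
   r_(t+1) <= C^(1+nu) r_t over the next one, by the recurrence itself. *)

(** * Inner products, the Euclidean norm and singular values *)

Section EuclideanSpace.
Variable R : realType.

Definition dotv (p : nat) (u v : 'cV[R]_p) : R := (u^T *m v) 0 0.

Lemma dotvE p (u v : 'cV[R]_p) : dotv u v = \sum_i u i 0 * v i 0.
Proof. by rewrite /dotv mxE; apply: eq_bigr => i _; rewrite mxE. Qed.

Lemma dotvC p (u v : 'cV[R]_p) : dotv u v = dotv v u.
Proof. by rewrite !dotvE; apply: eq_bigr => i _; rewrite mulrC. Qed.

Lemma dotvDr p (u v w : 'cV[R]_p) : dotv u (v + w) = dotv u v + dotv u w.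
Proof. by rewrite /dotv mulmxDr mxE. Qed.

Lemma dotvZr p (u v : 'cV[R]_p) a : dotv u (a *: v) = a * dotv u v.
Proof. by rewrite /dotv -scalemxAr mxE. Qed.

Lemma dotvNr p (u v : 'cV[R]_p) : dotv u (- v) = - dotv u v.
Proof. by rewrite -scaleN1r dotvZr mulN1r. Qed.

Lemma dotvBr p (u v w : 'cV[R]_p) : dotv u (v - w) = dotv u v - dotv u w.
Proof. by rewrite dotvDr dotvNr. Qed.

Lemma dotvDl p (u v w : 'cV[R]_p) : dotv (v + w) u = dotv v u + dotv w u.
Proof. by rewrite dotvC dotvDr !(dotvC u). Qed.

Lemma dotvZl p (u v : 'cV[R]_p) a : dotv (a *: v) u = a * dotv v u.
Proof. by rewrite dotvC dotvZr dotvC. Qed.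

Lemma dotv0 p (u : 'cV[R]_p) : dotv u 0 = 0.
Proof. by rewrite /dotv mulmx0 mxE. Qed.

Lemma dotv_sumr p (u : 'cV[R]_p) I (r : seq I) (P : pred I) (F : I -> 'cV[R]_p) :
  dotv u (\sum_(i <- r | P i) F i) = \sum_(i <- r | P i) dotv u (F i).
Proof. by rewrite /dotv mulmx_sumr summxE. Qed.

Lemma dotv_mull p q (A : 'M[R]_(p, q)) u v :
  dotv (A *m u) v = dotv u (A^T *m v).
Proof. by rewrite /dotv trmx_mul mulmxA. Qed.

Lemma dotvv_ge0 p (v : 'cV[R]_p) : 0 <= dotv v v.
Proof. by rewrite dotvE; apply: sumr_ge0 => i _; rewrite -expr2 sqr_ge0. Qed.

Lemma dotvv_eq0 p (v : 'cV[R]_p) : dotv v v = 0 -> v = 0.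
Proof.
rewrite dotvE => /psumr_eq0P v0; apply/colP => i; rewrite mxE.
have /eqP : v i 0 * v i 0 = 0 by apply: v0 => // j _; rewrite -expr2 sqr_ge0.
by rewrite mulf_eq0 orbb => /eqP.
Qed.

(** The quadratic [t -> a + 2 t b + t^2 c] is nonnegative; for [c > 0] evaluate it at its minimizer
    [- b / c]. For [c = 0] it is affine, and a nonzero [b] would make it reach -1. *)
Lemma psd_cauchy_schwarz p (B : 'M[R]_p) (u v : 'cV[R]_p) : B^T = B ->
    (forall w, 0 <= dotv w (B *m w)) ->
  dotv u (B *m v) ^+ 2 <= dotv u (B *m u) * dotv v (B *m v).
Proof.
move=> Bs B0; set a := dotv u (B *m u); set b := dotv u _; set c := dotv v _.
have P t : 0 <= a + 2 * t * b + t ^+ 2 * c.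
  have := B0 (u + t *: v).
  rewrite mulmxDr -scalemxAr dotvDr !dotvDl !dotvZr !dotvZl -/a -/b -/c.
  rewrite -{1}Bs -dotv_mull dotvC -/b; congr (_ <= _); ring.
have a0 : 0 <= a by exact: B0.
have [c0|c0] := ltP 0 c.
  have := P (- (b / c)).
  have -> : a + 2 * - (b / c) * b + (- (b / c)) ^+ 2 * c = (a * c - b ^+ 2) / c.
    by field; rewrite gt_eqF.
  by rewrite pmulr_lge0 ?invr_gt0// subr_ge0.
have -> : c = 0 by apply/eqP; rewrite eq_le c0 B0.
rewrite mulr0; have [->|b0] := eqVneq b 0; first by rewrite expr0n.
have := P (- ((a + 1) / (2 * b))).
have c00 : c = 0 by apply/eqP; rewrite eq_le c0 B0.
have -> : a + 2 * - ((a + 1) / (2 * b)) * b + (- ((a + 1) / (2 * b))) ^+ 2 * c = -1.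
  by rewrite c00; field.
by rewrite lerNr oppr0 ler10.
Qed.

Lemma enorm_ge0 p (v : 'cV[R]_p) : 0 <= enorm v.
Proof. exact: sqrtr_ge0. Qed.

Lemma enormE p (v : 'cV[R]_p) : enorm v = Num.sqrt (dotv v v).
Proof. by rewrite dotvE; congr Num.sqrt; apply: eq_bigr => i _; rewrite expr2. Qed.

Lemma sqr_enorm p (v : 'cV[R]_p) : enorm v ^+ 2 = dotv v v.
Proof. by rewrite enormE sqr_sqrtr ?dotvv_ge0. Qed.

Lemma enorm0_eq0 p (v : 'cV[R]_p) : enorm v = 0 -> v = 0.
Proof. by move=> v0; apply: dotvv_eq0; rewrite -sqr_enorm v0 expr0n. Qed.

Lemma enorm0 p : enorm (0 : 'cV[R]_p) = 0.
Proof. by rewrite enormE dotv0 sqrtr0. Qed.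

Lemma enorm_gt0 p (v : 'cV[R]_p) : v != 0 -> 0 < enorm v.
Proof.
by move=> v0; rewrite lt_neqAle enorm_ge0 andbT eq_sym; apply: contra v0 => /eqP /enorm0_eq0 ->.
Qed.

Lemma enormZ p a (v : 'cV[R]_p) : enorm (a *: v) = `|a| * enorm v.
Proof.
by rewrite !enormE dotvZl dotvZr mulrA -expr2 sqrtrM ?sqr_ge0// sqrtr_sqr.
Qed.

Lemma enormN p (v : 'cV[R]_p) : enorm (- v) = enorm v.
Proof. by rewrite -scaleN1r enormZ normrN1 mul1r. Qed.

Lemma dotv_le p (u v : 'cV[R]_p) : `|dotv u v| <= enorm u * enorm v.
Proof.
rewrite -(@ler_pXn2r _ 2)// ?nnegrE ?mulr_ge0 ?enorm_ge0//.
rewrite exprMn !sqr_enorm real_normK ?num_real//.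
have := @psd_cauchy_schwarz _ 1%:M u v; rewrite !mul1mx; apply; first exact: trmx1.
by move=> w; rewrite mul1mx dotvv_ge0.
Qed.

(** Duality, with [v = u] as the decisive test vector. Vector bounds below are thereby reduced to
    scalar ones. *)
Lemma enorm_le_dot p (u : 'cV[R]_p) C :
  0 <= C -> (forall v, dotv v u <= enorm v * C) -> enorm u <= C.
Proof.
move=> C0 /(_ u); rewrite -sqr_enorm expr2.
have [->//|u0] := eqVneq u 0; first by rewrite enorm0.
by rewrite ler_pM2l ?enorm_gt0.
Qed.

Lemma enormD p (u v : 'cV[R]_p) : enorm (u + v) <= enorm u + enorm v.
Proof.
apply: enorm_le_dot; first by rewrite addr_ge0 ?enorm_ge0.
move=> w; rewrite dotvDr mulrDr.
by apply: lerD; apply: le_trans (ler_norm _) (dotv_le _ _).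
Qed.

(** Cauchy-Schwarz row by row gives the Frobenius norm as a bound; adding 1 makes the constant
    positive even for [A = 0]. *)
Lemma enorm_mulmx_bounded p q (A : 'M[R]_(p, q)) :
  exists2 C, 0 < C & forall v, enorm (A *m v) <= C * enorm v.
Proof.
pose D := \sum_i enorm (row i A)^T ^+ 2.
have D0 : 0 <= D by apply: sumr_ge0 => i _; rewrite sqr_ge0.
exists (Num.sqrt D + 1) => [|v]; first by rewrite ltr_pwDr// sqrtr_ge0.
apply: (@le_trans _ _ (Num.sqrt D * enorm v)); last first.
  by rewrite ler_wpM2r ?enorm_ge0// lerDl.
rewrite -(@ler_pXn2r _ 2)// ?nnegrE ?mulr_ge0 ?enorm_ge0 ?sqrtr_ge0//.
rewrite exprMn (sqr_sqrtr D0) /D mulr_suml [leLHS]sqr_enorm dotvE; apply: ler_sum => i _.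
have -> : (A *m v) i 0 = dotv (row i A)^T v.
  by rewrite mxE dotvE; apply: eq_bigr => j _; rewrite !mxE.
rewrite -expr2 -exprMn -real_normK ?num_real//.
by rewrite lerXn2r ?nnegrE ?mulr_ge0 ?enorm_ge0// dotv_le.
Qed.

Lemma spectral_norm_ub p q (A : 'M[R]_(p, q)) v :
  enorm (A *m v) <= spectral_norm A * enorm v.
Proof.
have [->|v0] := eqVneq v 0; first by rewrite mulmx0 !enorm0 mulr0.
have n0 := enorm_gt0 v0; rewrite -ler_pdivrMr//.
rewrite mulrC -[_^-1]gtr0_norm ?invr_gt0// -enormZ scalemxAr.
apply: ub_le_sup; last first.
  exists ((enorm v)^-1 *: v) => //=.
  by rewrite enormZ gtr0_norm ?invr_gt0// mulVf// gt_eqF.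
have [C C0 CP] := enorm_mulmx_bounded A.
exists C => _ [w /= w1 <-]; apply: le_trans (CP w) _.
by rewrite ler_piMr// ltW.
Qed.

(** No compactness is involved: Cauchy-Schwarz for the form [B], applied to [B v] and [v], gives
    [|B v|^2 <= C <v, B v>], while the inverse gives [|v| <= D |B v|]. *)
Lemma psd_unit_coercive p (B : 'M[R]_p) : B^T = B ->
    (forall w, 0 <= dotv w (B *m w)) -> B \in unitmx ->
  exists2 e, 0 < e & forall v, e * dotv v v <= dotv v (B *m v).
Proof.
move=> Bs B0 Bu; have [C C0 CP] := enorm_mulmx_bounded B.
have [D D0 DP] := enorm_mulmx_bounded (invmx B).
exists (C * D ^+ 2)^-1 => [|v]; first by rewrite invr_gt0 mulr_gt0 ?exprn_gt0.
rewrite mulrC ler_pdivrMr ?mulr_gt0 ?exprn_gt0//.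
have h1 : enorm v <= D * enorm (B *m v) by rewrite -{1}(mulKmx Bu v) DP.
have h2 : enorm (B *m v) ^+ 2 <= C * dotv v (B *m v).
  have [->|Bv0] := eqVneq (enorm (B *m v)) 0.
    by rewrite expr0n mulr_ge0// ltW.
  have Bv : 0 < enorm (B *m v) ^+ 2 by rewrite exprn_gt0// lt_neqAle eq_sym Bv0 enorm_ge0.
  have := psd_cauchy_schwarz (B *m v) v Bs B0.
  rewrite -sqr_enorm => h; rewrite -(ler_pM2l Bv) -expr2; apply: le_trans h _.
  rewrite mulrA; apply: ler_wpM2r => //.
  apply: le_trans (ler_norm _) _; apply: le_trans (dotv_le _ _) _.
  by rewrite expr2 -mulrA [X in _ <= _ * X]mulrC ler_wpM2l ?enorm_ge0.
rewrite -sqr_enorm; apply: le_trans (_ : (D * enorm (B *m v)) ^+ 2 <= _).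
  by rewrite lerXn2r ?nnegrE ?mulr_ge0 ?enorm_ge0// ltW.
rewrite exprMn (_ : _ * (C * _) = D ^+ 2 * (C * dotv v (B *m v))); last by ring.
by rewrite ler_wpM2l ?sqr_ge0.
Qed.

(* The least singular value is the square root of the largest l such that
   A^T A - l is positive semidefinite: at this l the matrix is singular, since
   otherwise it would be coercive and l could be increased. *)
Lemma least_singular_value p q (A : 'M[R]_(p, q)) : (0 < q)%N -> (q <= p)%N ->
  exists2 s, singular_value A s & forall v, s * enorm v <= enorm (A *m v).
Proof.
move=> q0 qp; pose E := [set l : R | forall v, l * dotv v v <= dotv (A *m v) (A *m v)]%classic.
have E0 : E 0 by move=> v; rewrite mul0r dotvv_ge0.
pose e : 'cV[R]_q := delta_mx (Ordinal q0) 0.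
have e1 : dotv e e = 1 by rewrite /dotv /e trmx_delta mul_delta_mx mxE !eqxx.
have hsE : has_sup E.
  split; first by exists 0.
  by exists (dotv (A *m e) (A *m e)) => l /(_ e); rewrite e1 mulr1.
pose l := sup E; have l0 : 0 <= l by apply: ub_le_sup => //; case: hsE.
have El : E l.
  move=> v; have [->|v0] := eqVneq v 0; first by rewrite mulmx0 !dotv0 mulr0.
  have n0 : 0 < dotv v v by rewrite -sqr_enorm exprn_gt0// enorm_gt0.
  rewrite -ler_pdivlMr//; apply: ge_sup; first by exists 0.
  by move=> x /(_ v); rewrite ler_pdivlMr.
pose B := A^T *m A - l%:M.
have BE w : dotv w (B *m w) = dotv (A *m w) (A *m w) - l * dotv w w.
  by rewrite mulmxBl dotvBr mul_scalar_mx dotvZr dotv_mull mulmxA.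
have Bs : B^T = B by rewrite linearB /= trmx_mul trmxK tr_scalar_mx.
have B0 w : 0 <= dotv w (B *m w) by rewrite BE subr_ge0 El.
have /negP Bu : ~ (B \in unitmx).
  move=> /(psd_unit_coercive Bs B0)[eps eps0 epsP].
  suff : l + eps <= l by rewrite gerDl leNgt eps0.
  apply: ub_le_sup; first by case: hsE.
  by move=> v; have := epsP v; rewrite BE mulrDl lerBrDl.
move: Bu; rewrite unitmxE unitfE negbK => /det0P[b' b'0 b'B].
pose b1 := b'^T; have b10 : b1 != 0 by rewrite -(inj_eq trmx_inj) trmxK trmx0.
have Bb1 : B *m b1 = 0 by rewrite -Bs -trmx_mul b'B trmx0.
pose b := (enorm b1)^-1 *: b1.
have nb : enorm b = 1.
  by rewrite enormZ gtr0_norm ?invr_gt0 ?enorm_gt0// mulVf// gt_eqF// enorm_gt0.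
have AAb : A^T *m (A *m b) = l *: b.
  have : B *m b = 0 by rewrite -scalemxAr Bb1 scaler0.
  by rewrite mulmxBl mul_scalar_mx mulmxA => /subr0_eq.
have nAb : enorm (A *m b) = Num.sqrt l.
  by rewrite enormE dotv_mull AAb dotvZr -sqr_enorm nb expr1n mulr1.
have min v : Num.sqrt l * enorm v <= enorm (A *m v).
  by rewrite !enormE -sqrtrM// ler_sqrt ?dotvv_ge0.
have [sl0|sl0] := eqVneq (Num.sqrt l) 0; last first.
  exists (Num.sqrt l) => //; split; first exact: sqrtr_ge0.
  have sl : 0 < Num.sqrt l by rewrite lt_neqAle eq_sym sl0 sqrtr_ge0.
  exists ((Num.sqrt l)^-1 *: (A *m b)), b; split => //.
  - by rewrite enormZ nAb gtr0_norm ?invr_gt0// mulVf.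
  - by rewrite scalerA mulfV// scale1r.
  rewrite -scalemxAr AAb scalerA -{2}(sqr_sqrtr l0) expr2 mulrA mulVf//.
  by rewrite mul1r.
exists 0; last by move=> v; rewrite mul0r enorm_ge0.
have Ab0 : A *m b = 0 by apply: enorm0_eq0; rewrite nAb.
(* The singular value 0 also requires a left singular vector. If the left kernel were trivial, then
   [\rank A = p >= q] would make [A] left invertible, against [A b = 0]. *)
have [a0 a00 a0A] : exists2 a : 'rV[R]_p, a != 0 & a *m A = 0.
  have : kermx A != 0.
    rewrite kermx_eq0; apply/negP => /eqP rA.
    have Afull : row_full A by rewrite /row_full; apply/eqP/anti_leq; rewrite rank_leq_col rA.
    have [C CA] := row_fullP Afull.
    have b0 : b = 0 by rewrite -(mul1mx b) -CA -mulmxA Ab0 mulmx0.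
    by move: nb; rewrite b0 enorm0 => /eqP; rewrite eq_sym oner_eq0.
  by move=> /rowV0Pn[a /sub_kermxP aA a0]; exists a.
have a0T : a0^T != 0 by rewrite -(inj_eq trmx_inj) trmxK trmx0.
split => //; exists ((enorm a0^T)^-1 *: a0^T), b; split => //.
- by rewrite enormZ gtr0_norm ?invr_gt0 ?enorm_gt0// mulVf// gt_eqF// enorm_gt0.
- by rewrite Ab0 scale0r.
- by rewrite -scalemxAr -trmx_mul a0A trmx0 scaler0 scale0r.
Qed.

Lemma sigma_min_le p q (A : 'M[R]_(p, q)) v : (0 < q)%N -> (q <= p)%N ->
  sigma_min A * enorm v <= enorm (A *m v).
Proof.
move=> q0 qp; have [s As sP] := least_singular_value A q0 qp.
apply: le_trans (sP v); apply: ler_wpM2r; first exact: enorm_ge0.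
by apply: ge_inf => //; exists 0 => x [].
Qed.

(** Every singular value is at least [C^-1], where [C] bounds the inverse. Since the infimum of the
    empty set is 0 by convention, a singular value must also be exhibited. *)
Lemma sigma_min_unit_gt0 p (A : 'M[R]_p) :
  (0 < p)%N -> A \in unitmx -> 0 < sigma_min A.
Proof.
move=> p0 Au; have [s0 As0 _] := least_singular_value A p0 (leqnn p).
have [C C0 CP] := enorm_mulmx_bounded (invmx A).
apply: (@lt_le_trans _ _ C^-1); first by rewrite invr_gt0.
apply: lb_le_inf; first by exists s0.
move=> s [s_ge0 [a [b [na nb Ab _]]]].
rewrite -div1r ler_pdivrMr// mulrC -nb -{1}(mulKmx Au b).
by apply: le_trans (CP _) _; rewrite Ab enormZ na mulr1 ger0_norm.
Qed.

End EuclideanSpace.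

(** * Derivatives along lines and Taylor remainders *)

Section Calculus.
Variable R : realType.

(** The difference [phi] of [g] and [K s^(1+nu)] has nonpositive derivative on the open unit
    interval, hence [phi 1 <= phi 0]. *)
Lemma increment_le_powR (g g' : R -> R) (K nu : R) : 0 < nu ->
    (forall s : R, is_derive s (1 : R) g (g' s)) ->
    (forall s : R, 0 < s -> s < 1 -> g' s <= K * (1 + nu) * s `^ nu) ->
  g 1 - g 0 <= K.
Proof.
move=> nu0 dg g'K; have nu10 : 0 < 1 + nu by rewrite addr_gt0.
pose phi := g - (K \*: (fun s : R => s `^ (1 + nu))).
have cg (s : R) : {for s, continuous g}.
  by apply/differentiable_continuous/derivable1_diffP; case: (dg s).
have dphi (s : R) : 0 < s -> is_derive s (1 : R) phi (g' s - K *: ((1 + nu) * s `^ (1 + nu - 1))).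
  by move=> s0; apply: is_deriveB; apply: is_deriveZ; exact: is_derive1_powR.
have cphi (s : R) : 0 < s -> {for s, continuous phi}.
  by move=> s0; apply/differentiable_continuous/derivable1_diffP; case: (dphi s s0).
have : phi 1 <= phi 0.
  apply: (@ler0_derive1_nincr _ phi 0 1) => //.
  - by move=> s; rewrite in_itv/= => /andP[s0 _]; case: (dphi s s0).
  - move=> s; rewrite in_itv/= => /andP[s0 s1].
    have [_] := dphi s s0; rewrite derive1E => ->.
    by rewrite (_ : 1 + nu - 1 = nu) ?subr_le0 ?[_ *: _]mulrA ?g'K//; ring.
  - apply/continuous_within_itvP => //; split.
    + by move=> s; rewrite in_itv/= => /andP[s0 _]; exact: cphi.
    (* The derivative formula for the power is used for [s > 0] only, so continuity at 0 from the
       right is shown separately. *)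
    + apply: cvgB; first by apply: cvg_at_right_filter; exact: cg.
      apply: cvgZl_tmp; rewrite powR0 ?gt_eqF//; exact: powR_cvg0.
    + by apply: cvg_at_left_filter; exact: cphi.
rewrite /phi !fctE /= powR1 powR0 ?gt_eqF// scaler0 subr0 [_ *: _]mulr1; lra.
Qed.

Variables (d n : nat) (f : 'cV[R]_d -> 'cV[R]_n).
Hypothesis f_diff : forall x, differentiable f x.

(** The entries of [jac] are mere partial derivatives; differentiability makes the directional
    derivative linear in [h], so that they determine it. *)
Lemma jac_mulmxE (x h : 'cV[R]_d) i :
  (jac f x *m h) i 0 = 'D_h (fun y => f y i 0) x.
Proof.
have df : differentiable (fun y => f y i 0) x.
  apply: (@differentiable_comp _ _ _ _ f (fun v : 'cV[R]_n => v i 0 : R)) => //.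
  exact: differentiable_coord.
rewrite deriveE// {2}[h]matrix_sum_delta mxE linear_sum; apply: eq_bigr => a _ /=.
by rewrite big_ord1 linearZ /= !mxE deriveE// mulrC.
Qed.

Lemma is_derive_dot_line (w : 'cV[R]_n) (x h : 'cV[R]_d) (s : R) :
  is_derive s (1 : R) (fun s => dotv w (f (x + s *: h))) (dotv w (jac f (x + s *: h) *m h)).
Proof.
have dF i : is_derive s (1 : R) (fun s => f (x + s *: h) i 0) ((jac f (x + s *: h) *m h) i 0).
  rewrite jac_mulmxE.
  (* Both derivatives are limits of the same difference quotient. *)
  have E : (fun t : R => t^-1 *: (((fun s => f (x + s *: h) i 0) \o shift s) (t *: 1)
              - f (x + s *: h) i 0)) =
           (fun t : R => t^-1 *: (((fun y => f y i 0) \o shift (x + s *: h)) (t *: h)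
              - f (x + s *: h) i 0)).
    apply/funext => t /=; rewrite [t *: 1]mulr1; congr (_ *: (f _ _ _ - _)).
    by rewrite scalerDl addrCA.
  have df : derivable (fun y => f y i 0) (x + s *: h) h.
    apply: diff_derivable.
    apply: (@differentiable_comp _ _ _ _ f (fun v : 'cV[R]_n => v i 0 : R)) => //.
    exact: differentiable_coord.
  by split; rewrite /derivable /derive E.
have -> : (fun s => dotv w (f (x + s *: h))) =
          \sum_i (w i 0 \*: (fun s => f (x + s *: h) i 0)).
  by apply/funext => t; rewrite dotvE fct_sumE.
by rewrite dotvE; apply: is_derive_sum => i; apply: is_deriveZ.
Qed.

(* Testing against a fixed w replaces the vector-valued integral form of the
   remainder by a monotonicity argument for a real function. *)
Lemma taylor_holder (Hnu nu : R) (x y : 'cV[R]_d) (w : 'cV[R]_n) : 0 < nu ->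
    (forall x y, spectral_norm (jac f x - jac f y) <= Hnu * enorm (x - y) `^ nu) ->
  dotv w (f y - f x - jac f x *m (y - x)) <=
    enorm w * (Hnu / (1 + nu) * enorm (x - y) `^ (1 + nu)).
Proof.
move=> nu0 hol; have nu10 : 0 < 1 + nu by rewrite addr_gt0.
pose h := y - x; pose K := enorm w * (Hnu / (1 + nu) * enorm (x - y) `^ (1 + nu)).
pose A := dotv w (jac f x *m h).
pose g := (fun s => dotv w (f (x + s *: h))) - (A \*: id).
have dg (s : R) : is_derive s (1 : R) g (dotv w (jac f (x + s *: h) *m h) - A *: 1).
  by apply: is_deriveB; apply: is_derive_dot_line.
have -> : dotv w (f y - f x - jac f x *m (y - x)) = g 1 - g 0.
  rewrite /g !fctE /= scale1r scale0r addr0 scaler0 subr0 [_ *: _]mulr1.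
  by rewrite [x + h]addrC /h subrK !dotvBr -/h addrAC.
apply: (increment_le_powR nu0 dg) => s s0 s1.
rewrite [A *: _]mulr1 /A -dotvBr -mulmxBl.
apply: le_trans (ler_norm _) _; apply: le_trans (dotv_le _ _) _.
rewrite /K -!mulrA ler_wpM2l ?enorm_ge0//.
apply: le_trans (spectral_norm_ub _ _) _.
have hxy : enorm h = enorm (x - y) by rewrite /h -opprB enormN.
rewrite hxy; apply: le_trans (ler_wpM2r (enorm_ge0 _) (hol _ _)) _.
rewrite addrC addKr enormZ gtr0_norm// powRM ?enorm_ge0 ?(ltW s0)//.
rewrite hxy (_ : enorm (x - y) `^ (1 + nu) = enorm (x - y) * enorm (x - y) `^ nu).
  by rewrite le_eqVlt; apply/orP; left; apply/eqP; field; rewrite gt_eqF.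
rewrite powRD ?powRr1 ?enorm_ge0//.
by rewrite gt_eqF.
Qed.

(** Against a fixed [w], the difference quotients of [f] along [h] are at most [|w| L |h|], and the
    bound passes to the limit. *)
Lemma jac_lipschitz (L : R) (x h : 'cV[R]_d) : 0 <= L ->
    (forall x y, enorm (f x - f y) <= L * enorm (x - y)) ->
  enorm (jac f x *m h) <= L * enorm h.
Proof.
move=> L0 lip; apply: enorm_le_dot; first by rewrite mulr_ge0 ?enorm_ge0.
move=> w; have := is_derive_dot_line w x h 0; rewrite scale0r addr0 => -[dF <-].
apply: limr_le => //; near=> t.
have t0 : t != 0 by near: t; exact: nbhs_dnbhs_neq.
rewrite /= addr0 [t *: 1]mulr1 scale0r addr0.
apply: le_trans (ler_norm _) _; rewrite normrM -dotvBr normfV mulrC.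
rewrite ler_pdivrMr ?normr_gt0//; apply: le_trans (dotv_le _ _) _.
rewrite -mulrA ler_wpM2l ?enorm_ge0//; apply: le_trans (lip _ _) _.
by rewrite addrC addKr enormZ -mulrA [`|t| * _]mulrC.
Unshelve. all: by end_near. Qed.

End Calculus.

(** * The scalar recurrence with delay and its rates *)

Section DelayedRecurrence.

(* The truncated subtraction makes the history before time 0 constant. *)
Lemma delay_sequence (T : Type) (x : T) (F : (nat -> T) -> T) :
  exists r : nat -> T, r 0%N = x /\ forall t, r t.+1 = F (fun s => r (t - s)%N).
Proof.
(* [h t] is the whole history seen from time [t]: [h t s] is the value at time [t - s]. *)
pose h := fix h t : nat -> T := if t is t'.+1
  then fun s => if s is s'.+1 then h t' s' else F (h t') else fun=> x.
have hE t s : h t s = h (t - s)%N 0%N.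
  by elim: t s => [|t IH] [|s] //=; rewrite IH subSS.
exists (h^~ 0%N); split => // t /=; congr F; apply/funext => s; exact: hE.
Qed.

Variables (R : realType) (a rho nu : R) (m' : nat) (r : nat -> R).
Let m := m'.+1.
Let q := 1 / (2 * (1 + nu)).
Let c := 1 - m%:R^-1 * (1 - q `^ (1 + nu)).
Hypotheses (nu0 : 0 < nu) (a0 : 0 <= a) (rho0 : 0 < rho).
Hypothesis a_rho : a * m%:R * rho `^ nu <= q.
Hypothesis r0 : r 0%N = rho.
Hypothesis rS : forall t, r t.+1 = a * \sum_(s < m) r (t - s)%N `^ (1 + nu).

Let nu10 : 0 < 1 + nu. Proof. by rewrite addr_gt0. Qed.
Let q_gt0 : 0 < q. Proof. by rewrite divr_gt0 ?mulr_gt0. Qed.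
Let q_le1 : q <= 1.
Proof. by rewrite ler_pdivrMr ?mulr_gt0// mul1r; have := nu0; lra. Qed.

Lemma delay_ge0 t : 0 <= r t.
Proof.
case: t => [|t]; first by rewrite r0 ltW.
by rewrite rS mulr_ge0// sumr_ge0// => s _; exact: powR_ge0.
Qed.

Let powR_mono x y : 0 <= x -> x <= y -> x `^ (1 + nu) <= y `^ (1 + nu).
Proof.
by move=> x0 xy; apply: ge0_ler_powR; rewrite ?nnegrE// ?(ltW nu10)// (le_trans x0).
Qed.

Let powRS x : 0 <= x -> x `^ (1 + nu) = x * x `^ nu.
Proof. by move=> x0; rewrite powRD ?powRr1// gt_eqF. Qed.

(** Strong induction. The first step uses [a m rho^nu <= q <= 1]; afterwards the two sums are
    compared term by term. *)
Lemma delay_noninc1 t : r t.+1 <= r t.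
Proof.
elim/ltn_ind: t => -[_|t IH].
  rewrite rS r0 (eq_bigr (fun=> rho `^ (1 + nu))); last by move=> s _; rewrite -r0.
  rewrite sumr_const card_ord -mulr_natl powRS ?(ltW rho0)//.
  rewrite (_ : a * _ = a * m%:R * rho `^ nu * rho); last by ring.
  by rewrite ler_piMl ?(ltW rho0)// (le_trans a_rho).
rewrite !rS ler_wpM2l//; apply: ler_sum => s _; apply: powR_mono; first exact: delay_ge0.
have [st|ts] := leqP s t; first by rewrite subSn// IH// ltnS leq_subr.
(* For [s > t] both indices are truncated to 0. *)
by rewrite (eqP ts) (eqP (ltnW ts)).
Qed.

Lemma delay_noninc s t : (s <= t)%N -> r t <= r s.
Proof.
move=> /subnK <-; elim: (t - s)%N => // k IH.
by rewrite addSn (le_trans (delay_noninc1 _)).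
Qed.

Lemma delay_bound t : (m <= t)%N -> r t <= a * m%:R * r (t - m)%N `^ (1 + nu).
Proof.
case: t => // t; rewrite /m ltnS => mt; rewrite rS -mulrA ler_wpM2l// subSS.
rewrite mulr_natl -[m'.+1 in leRHS]card_ord -sumr_const; apply: ler_sum => s _.
apply: powR_mono; first exact: delay_ge0.
by apply: delay_noninc; rewrite leq_sub2l// -ltnS.
Qed.

(** One factor [r^nu] of the power is at most [rho^nu], which [a_rho] absorbs into [q]. *)
Lemma delay_contract t : (m <= t)%N -> r t <= q * r (t - m)%N.
Proof.
move=> mt; apply: le_trans (delay_bound mt) _.
rewrite powRS ?delay_ge0// [r _ * _]mulrC mulrA ler_wpM2r ?delay_ge0//.
apply: le_trans a_rho; apply: ler_wpM2l; first by rewrite mulr_ge0.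
apply: ge0_ler_powR; rewrite ?nnegrE ?delay_ge0 ?(ltW nu0) ?(ltW rho0)//.
by rewrite -r0 delay_noninc.
Qed.

Let q1_le1 : q `^ (1 + nu) <= 1.
Proof. by apply: le_trans (powR_mono (ltW q_gt0) q_le1) _; rewrite powR1. Qed.

Let c_ge0 : 0 <= c.
Proof.
rewrite subr_ge0 mulrC ler_pdivrMr// mul1r (@le_trans _ _ 1) ?ler1n//.
by rewrite gerBl powR_ge0.
Qed.

(** Consecutive sums differ only by the terms entering and leaving the window, so the decrease is
    [a (p^(1+nu) - r_t^(1+nu))] with [p = r_(t-m)]. Here [r_t <= q p] by contraction and
    [a p^(1+nu) >= r_t / m] by [delay_bound], so the decrease is at least
    [(1 - q^(1+nu)) r_t / m]. *)
Lemma delay_linear_rate t : (m <= t)%N -> r t.+1 <= c * r t.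
Proof.
move=> mt; have := delay_contract mt; have := delay_bound mt.
case: t mt => // t; rewrite /m ltnS => mt.
set p := r (t.+1 - m)%N => b1 b2.
have E : r t.+2 = r t.+1 - a * (p `^ (1 + nu) - r t.+1 `^ (1 + nu)).
  pose Sg := \sum_(s < m') r (t - s)%N `^ (1 + nu).
  have e1 : r t.+2 = a * (r t.+1 `^ (1 + nu) + Sg).
    by rewrite rS big_ord_recl subn0.
  have e2 : r t.+1 = a * (Sg + p `^ (1 + nu)) by rewrite rS big_ord_recr.
  by rewrite e1 [X in X - _]e2; ring.
have p0 : 0 <= p := delay_ge0 _.
have h : r t.+1 `^ (1 + nu) <= q `^ (1 + nu) * p `^ (1 + nu).
  by rewrite -powRM ?(ltW q_gt0)// powR_mono ?delay_ge0.
have m0 : 0 < m%:R :> R by rewrite ltr0n.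
have h2 : r t.+1 / m%:R <= a * p `^ (1 + nu) by rewrite ler_pdivrMr// mulrAC.
have k0 : 0 <= 1 - q `^ (1 + nu) by rewrite subr_ge0.
rewrite E /c mulrBl mul1r lerD2l lerN2.
apply: (@le_trans _ _ (a * ((1 - q `^ (1 + nu)) * p `^ (1 + nu)))).
  by rewrite [a * _]mulrCA [_^-1 * _]mulrC -mulrA [_^-1 * _]mulrC ler_wpM2l.
rewrite ler_wpM2l// mulrBl mul1r; lra.
Qed.

Lemma delay_superlinear_rate t : (m <= t)%N ->
  r t.+1 <= c `^ ((1 + nu) ^+ (t %/ m - 1)) * r t.
Proof.
(* The claim covers all times from epoch [j + 1] on, not that epoch alone, so the induction
   hypothesis applies to every index of a window. *)
suff epoch j : forall t, (j.+1 * m <= t)%N -> r t.+1 <= c `^ ((1 + nu) ^+ j) * r t.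
  by move=> mt; apply: epoch; rewrite subn1 prednK ?leq_divM// divn_gt0.
elim: j => [|j IH] {}t.
  by rewrite mul1n expr0 powRr1 => // ?; exact: delay_linear_rate.
case: t => // t jt; rewrite [r t.+2]rS [r t.+1]rS mulrCA ler_wpM2l// mulr_sumr.
apply: ler_sum => s _; have ms : (s <= m')%N by rewrite -ltnS.
(* Exact count: [t + 1 >= (j + 2) m] and [s <= m - 1] leave [t - s >= (j + 1) m]. *)
have st : (j.+1 * m <= t - s)%N.
  rewrite leq_subRL; last by rewrite (leq_trans ms)// -ltnS (leq_trans _ jt)// mulSn leq_addr.
  rewrite -ltnS (leq_trans _ jt)// [(j.+2 * m)%N]mulSn /m addSn ltnS leq_add2r //.
rewrite subSn; last by rewrite (leq_trans ms)// -ltnS (leq_trans _ jt)// mulSn leq_addr.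
apply: le_trans (powR_mono (delay_ge0 _) (IH _ st)) _.
by rewrite powRM ?powR_ge0 ?delay_ge0// -powRrM -exprSr.
Qed.

End DelayedRecurrence.

(** * The Woodbury identity for the inverse update *)

Section Woodbury.
Variables (F : fieldType) (p q : nat) (H : 'M[F]_p) (U V : 'M[F]_(p, q)).
Hypotheses (Hu : H \in unitmx) (HUVu : H + U *m V^T \in unitmx).
Let core := 1%:M + V^T *m invmx H *m U.

(** If [w] annihilates the core from the left, then [y = w V^T H^-1] satisfies [w = - y U] and
    [y (H + U V^T) = 0]; hence [y = 0] and [w = 0]. *)
Lemma woodbury_core_unit : core \in unitmx.
Proof.
rewrite unitmxE unitfE; apply/det0P => -[w w0 wC].
move: wC; rewrite mulmxDr mulmx1 !mulmxA => wC.
pose y := w *m V^T *m invmx H.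
have wE : w = - (y *m U) by apply/eqP; rewrite -addr_eq0 wC.
have yH : y *m H = w *m V^T by rewrite mulmxKV.
have y0 : y = 0.
  rewrite -[y](mulmxK HUVu) mulmxDr yH mulmxA {1}wE mulNmx addNr.
  by rewrite mul0mx.
by move: w0; rewrite wE y0 mul0mx oppr0 eqxx.
Qed.

Lemma woodbury :
  invmx (H + U *m V^T) =
  invmx H - invmx H *m U *m invmx core *m V^T *m invmx H.
Proof.
set X := RHS; suff E : (H + U *m V^T) *m X = 1%:M.
  by rewrite -[X](mulKmx HUVu) E mulmx1.
(* Replacing this product by [core - 1] lets the inverse of the core cancel in the cross term. *)
have CC : V^T *m invmx H *m U = core - 1%:M by rewrite /core addrC addKr.
rewrite /X mulmxBr !mulmxDl !mulmxA mulmxV// mul1mx.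
rewrite -(mulmxA U V^T) -(mulmxA U _ U) CC -(mulmxA U (core - _)).
rewrite mulmxBl mulmxV ?woodbury_core_unit// mul1mx mulmxBr mulmx1 !mulmxA.
by rewrite !mulmxBl [X in _ - X]addrC subrK addrK.
Qed.

End Woodbury.

(** * Estimates for one block of components *)

Section Blocks.
Variables (R : realType) (d n : nat) (f : 'cV[R]_d -> 'cV[R]_n).
Implicit Types (B : {set 'I_n}) (x y z v : 'cV[R]_d).

Lemma Ublock_mul_Vblock B y y' :
  Ublock f B y y' *m (Vblock f B y y')^T =
  - (\sum_(j in B) Hterm f j y) + \sum_(j in B) Hterm f j y'.
Proof.
rewrite tr_mxrow mul_mxrow_mxcol (big_enum_val (Hterm f ^~ y)).
rewrite (big_enum_val (Hterm f ^~ y')) -sumrN -big_split /=; apply: eq_bigr => l _.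
by rewrite -mulNmx -mul_row_col -tr_row_mx.
Qed.

Lemma dotv_grad j x v : dotv (grad f j x) v = (jac f x *m v) j 0.
Proof. by rewrite dotvE mxE; apply: eq_bigr => a _; rewrite [jac f x j a]mxE. Qed.

Lemma Hterm_mulmx j x v : Hterm f j x *m v = (jac f x *m v) j 0 *: grad f j x.
Proof.
by rewrite -mulmxA [_^T *m v]mx11_scalar -/(dotv _ _) dotv_grad mul_mx_scalar.
Qed.

(** At [v = xs], where [f] vanishes, the coefficient is the [j]-th Taylor remainder at [x]. *)
Lemma uterm_sub_Hterm j x v :
  uterm f j x - Hterm f j x *m v =
  (- f x - jac f x *m (v - x)) j 0 *: grad f j x.
Proof.
rewrite Hterm_mulmx -scalerBl /uterm -/(dotv _ _) dotv_grad mulmxBr !mxE.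
by congr (_ *: _); ring.
Qed.

Lemma trmx_Hterm j x : (Hterm f j x)^T = Hterm f j x.
Proof. by rewrite trmx_mul trmxK. Qed.

Lemma sum_Hterm x : \sum_j Hterm f j x = (jac f x)^T *m jac f x.
Proof.
apply/matrixP => a b; rewrite summxE mxE; apply: eq_bigr => j _.
by rewrite !mxE big_ord1 !mxE.
Qed.

(** Restriction to a block that keeps the full length, so that bounds on the whole of [f] and [jac]
    apply to a block. *)
Definition maskv p (B : {set 'I_p}) (w : 'cV[R]_p) : 'cV[R]_p :=
  \col_j (if j \in B then w j 0 else 0).

Lemma dotv_maskv p (B : {set 'I_p}) (w u : 'cV[R]_p) :
  dotv (maskv B w) u = \sum_(j in B) w j 0 * u j 0.
Proof.
rewrite dotvE [RHS]big_mkcond; apply: eq_bigr => j _; rewrite mxE.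
by case: ifP => // _; rewrite mul0r.
Qed.

Lemma enorm_maskv p (B : {set 'I_p}) (w : 'cV[R]_p) : enorm (maskv B w) <= enorm w.
Proof.
rewrite -(@ler_pXn2r _ 2)// ?nnegrE ?enorm_ge0// !sqr_enorm !dotvE.
apply: ler_sum => j _; rewrite mxE; case: ifP => // _.
by rewrite mul0r -expr2 sqr_ge0.
Qed.

Variables (L Hnu nu : R).
Hypotheses (L0 : 0 < L) (nu0 : 0 < nu) (Hnu0 : 0 < Hnu).
Hypothesis f_diff : forall x, differentiable f x.
Hypothesis f_lip : forall x y, enorm (f x - f y) <= L * enorm (x - y).
Hypothesis jac_holder : forall x y,
  spectral_norm (jac f x - jac f y) <= Hnu * enorm (x - y) `^ nu.

(** Tested against [v], the sum becomes the inner product of the masked [jac f z *m v], of norm at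
    most [L |v|], with the Taylor remainder. The constant is therefore independent of the block
    size. *)
Lemma block_residual_le B z xs : f xs = 0 ->
  enorm (\sum_(j in B) (uterm f j z - Hterm f j z *m xs)) <=
  L * (Hnu / (1 + nu)) * enorm (z - xs) `^ (1 + nu).
Proof.
move=> f0; have nu10 : 0 < 1 + nu by rewrite addr_gt0.
have K0 : 0 <= Hnu / (1 + nu) * enorm (z - xs) `^ (1 + nu).
  by rewrite mulr_ge0 ?powR_ge0// divr_ge0// ltW.
rewrite -mulrA; apply: enorm_le_dot; first by rewrite mulr_ge0// ltW.
move=> v; rewrite dotv_sumr.
under eq_bigr do rewrite uterm_sub_Hterm dotvZr dotvC dotv_grad mulrC.
rewrite -dotv_maskv -[- f z]add0r -f0.
apply: le_trans (taylor_holder f_diff _ _ _ nu0 jac_holder) _.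
rewrite [leRHS]mulrA ler_wpM2r// [leRHS]mulrC; apply: le_trans (enorm_maskv _ _) _.
exact: jac_lipschitz (ltW L0) f_lip.
Qed.

Lemma block_gram_perturb B z xs v :
  \sum_(j in B) (jac f xs *m v) j 0 ^+ 2 - \sum_(j in B) (jac f z *m v) j 0 ^+ 2 <=
  2 * L * Hnu * enorm (z - xs) `^ nu * enorm v ^+ 2.
Proof.
(* Difference of squares: the difference factor is controlled by Hoelder continuity, the sum factor
   by [2 L |v|]. *)
have E : \sum_(j in B) (jac f xs *m v) j 0 ^+ 2 - \sum_(j in B) (jac f z *m v) j 0 ^+ 2
    = - dotv (maskv B ((jac f z - jac f xs) *m v)) (jac f xs *m v + jac f z *m v).
  rewrite dotv_maskv -sumrB -sumrN mulmxBl.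
  by apply: eq_bigr => j _; move: (jac f xs *m v) (jac f z *m v) => a b; rewrite !mxE; ring.
rewrite E; apply: le_trans (ler_norm _) _; rewrite normrN.
apply: le_trans (dotv_le _ _) _.
rewrite (_ : 2 * L * Hnu * _ * _ =
  (Hnu * enorm (z - xs) `^ nu * enorm v) * (L * enorm v + L * enorm v)); last by ring.
apply: ler_pM; rewrite ?enorm_ge0//.
  apply: le_trans (enorm_maskv _ _) _; apply: le_trans (spectral_norm_ub _ _) _.
  by apply: ler_wpM2r; rewrite ?enorm_ge0.
apply: le_trans (enormD _ _) _.
by apply: lerD; exact: jac_lipschitz (ltW L0) f_lip.
Qed.

End Blocks.

(** * Combinatorics of the batches *)

Section Batches.
Variables (n k : nat) (S : nat -> {set 'I_n}).
Hypotheses (k0 : (0 < k)%N) (kn : (k <= n)%N) (S_part : batch_partition k S).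
Let m := nbatch n k.

Lemma nbatch_gt0 : (0 < m)%N.
Proof. by rewrite divn_gt0// (leq_trans kn)// leq_addr. Qed.

Lemma sum_batches (V : nmodType) (F : 'I_n -> V) :
  \sum_(i < m) \sum_(j in S i) F j = \sum_j F j.
Proof.
have [cov dis _] := S_part.
rewrite (exchange_big_dep predT)//=; apply: eq_bigr => j _.
have [i im ji] := cov j; rewrite (big_pred1 (Ordinal im))// => i' /=.
apply/idP/eqP => [ji'|->//]; apply/val_inj/eqP/negPn/negP => /= ii'.
by have /disjointFr/(_ ji') := dis _ _ (ltn_ord i') im ii'; rewrite ji.
Qed.

(** Only the last block is in question: were it empty, [n = (m - 1) k], against
    [m k <= n + k - 1]. *)
Lemma batch_card_gt0 i : (i < m)%N -> (0 < #|S i|)%N.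
Proof.
move=> im; have [cov dis cardS] := S_part.
have [i1m|mi1] := ltnP i.+1 m; first by rewrite cardS.
have mE : m = i.+1 by apply/eqP; rewrite eqn_leq mi1.
rewrite lt0n; apply/eqP => Si0.
have : n = (i * k)%N.
  have := sum_batches (fun=> 1%N); rewrite mE big_ord_recr /= !sum1_card Si0 addr0.
  rewrite card_ord => <-; rewrite (eq_bigr (fun=> k)).
    by rewrite sum_nat_const card_ord.
  by move=> j _; rewrite sum1_card cardS// -/m mE ltnS.
move=> nE; have : (i.+1 * k <= n + k.-1)%N by rewrite -mE leq_divM.
by rewrite nE mulSn addnC leq_add2l leqNgt ltn_predL k0.
Qed.

End Batches.

(** * Closed forms of the state in terms of the anchors *)

Section Algorithm.
Variables (R : realType) (d n : nat) (f : 'cV[R]_d -> 'cV[R]_n).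
Variables (k : nat) (S : nat -> {set 'I_n}) (x0 : 'cV[R]_d).
Hypotheses (k0 : (0 < k)%N) (kn : (k <= n)%N) (S_part : batch_partition k S).
Let m := nbatch n k.
Let st := mb_ign f k S x0.
Let m0 : (0 < m)%N := nbatch_gt0 k0 kn.

Lemma sum_update (V : zmodType) (T : Type) (F : nat -> T -> V) (z : nat -> T) i x :
    (i < m)%N ->
  \sum_(l < m) F l (if l == i :> nat then x else z l) =
  \sum_(l < m) F l (z l) - F i (z i) + F i x.
Proof.
move=> im; rewrite (bigD1 (Ordinal im))//= eqxx [in RHS](bigD1 (Ordinal im))//=.
rewrite [X in _ = X + _]addrAC subrr add0r addrC; congr (_ + _).
by apply: eq_bigr => l li; rewrite ifN.
Qed.

Definition Hsum (z : nat -> 'cV[R]_d) := \sum_(i < m) \sum_(j in S i) Hterm f j (z i).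

Definition usum (z : nat -> 'cV[R]_d) := \sum_(i < m) \sum_(j in S i) uterm f j (z i).

Lemma st_zS t i :
  st_z (st t.+1) i = if i == (t %% m)%N then st_x (st t.+1) else st_z (st t) i.
Proof. by rewrite /st /=; case: (mb_ign f k S x0 t). Qed.

Lemma st_xS t : st_x (st t.+1) = st_G (st t) *m st_u (st t).
Proof. by rewrite /st /=; case: (mb_ign f k S x0 t). Qed.

Lemma st_HS t : st_H (st t.+1) =
  st_H (st t) + ign_U f k S t (st t) *m (ign_V f k S t (st t))^T.
Proof.
rewrite Ublock_mul_Vblock addrA /st /= /next_x.
by case: (mb_ign f k S x0 t).
Qed.

Lemma st_GS t : st_G (st t.+1) = st_G (st t) -
  st_G (st t) *m ign_U f k S t (st t) *m invmx (ign_core f k S t (st t))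
    *m (ign_V f k S t (st t))^T *m st_G (st t).
Proof. by rewrite /st /=; case: (mb_ign f k S x0 t). Qed.

Lemma st_HE t : st_H (st t) = Hsum (st_z (st t)).
Proof.
elim: t => [|t IH].
  by apply: etrans (esym (sum_Hterm f x0)) _; rewrite -(sum_batches S_part).
rewrite /Hsum; under eq_bigr do rewrite st_zS.
rewrite (sum_update (fun i x => \sum_(j in S i) Hterm f j x)) ?ltn_mod//.
rewrite -[\sum_(l < m) _]/(Hsum _) -IH st_xS /st /= /next_x.
by case: (mb_ign f k S x0 t).
Qed.

Lemma st_uE t : st_u (st t) = usum (st_z (st t)).
Proof.
elim: t => [//|t IH].
rewrite /usum; under eq_bigr do rewrite st_zS.
rewrite (sum_update (fun i x => \sum_(j in S i) uterm f j x)) ?ltn_mod//.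
rewrite -[\sum_(l < m) _]/(usum _) -IH st_xS /st /= /next_x.
by case: (mb_ign f k S x0 t).
Qed.

(* For s < m, block t - s - 1 modulo m is the one refreshed by x^(t-s); for t <= s it
   still carries the initial anchor. *)
Lemma st_z_window t s : (s < m)%N ->
  st_z (st t) ((t + (m - s.+1)) %% m) = st_x (st (t - s)).
Proof.
elim: t s => [//|t IH] [|s] sm.
  rewrite subn1 addSn -addnS prednK// modnDr st_zS eqxx.
  by rewrite subn0.
rewrite st_zS subSS -IH 1?ltnW// addSn -addnS -subSn// subSS ifN//.
have ms : (0 < m - s.+1)%N by rewrite subn_gt0.
rewrite -[X in _ == X %[mod _]]addn0 eqn_modDl mod0n modn_small ?gtn_eqF//.
by rewrite ltn_subrL.
Qed.

(** The index [t + (m - s - 1)] modulo [m] meets each block exactly once as [s] runs below [m], so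
    the anchors can be listed by age. *)
Lemma sum_window (F : 'cV[R]_d -> R) t :
  \sum_(i < m) F (st_z (st t) i) = \sum_(s < m) F (st_x (st (t - s)%N)).
Proof.
pose h (s : 'I_m) := Ordinal (ltn_pmod (t + (m - s.+1)) m0).
have h_inj : injective h.
  move=> a b /(congr1 val) /= /eqP; rewrite eqn_modDl.
  have lt s : (m - s.+1 < m)%N by rewrite ltn_subrL.
  rewrite !modn_small// => /eqP e; apply/val_inj => /=.
  by have := ltn_ord a; have := ltn_ord b; lia.
rewrite (reindex_inj h_inj); apply: eq_bigr => s _ /=.
by rewrite st_z_window.
Qed.

(** * Error analysis inside the initial ball *)

Variables (L Hnu nu mu rho : R) (xs : 'cV[R]_d).
Hypotheses (L0 : 0 < L) (nu0 : 0 < nu) (Hnu0 : 0 < Hnu) (mu0 : 0 < mu).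
Hypothesis rho0 : 0 < rho.
Hypothesis f_diff : forall x, differentiable f x.
Hypothesis f_lip : forall x y, enorm (f x - f y) <= L * enorm (x - y).
Hypothesis jac_holder : forall x y,
  spectral_norm (jac f x - jac f y) <= Hnu * enorm (x - y) `^ nu.
Hypothesis f_xs : f xs = 0.
Hypothesis mu_xs : forall v, mu * enorm v <= enorm (jac f xs *m v).
Hypothesis rho_small : 4 * L * Hnu * m%:R * rho `^ nu <= mu ^+ 2.
Hypothesis x0_near : enorm (x0 - xs) <= rho.

(** The residual constant [L Hnu / (1 + nu)] divided by the coercivity constant [mu^2 / 2]. *)
Let a := 2 * L * Hnu / ((1 + nu) * mu ^+ 2).

Lemma trmx_Hsum z : (Hsum z)^T = Hsum z.
Proof.
rewrite linear_sum; apply: eq_bigr => i _; rewrite linear_sum.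
by apply: eq_bigr => j _; exact: trmx_Hterm.
Qed.

(** With all anchors at [xs] the form is [|jac f xs v|^2 >= mu^2 |v|^2]. Moving the anchors costs at
    most [2 L Hnu rho^nu |v|^2] per block, hence at most half of this over [m] blocks by
    [rho_small]. *)
Lemma Hsum_coercive z v : (forall i, enorm (z i - xs) <= rho) ->
  mu ^+ 2 / 2 * dotv v v <= dotv v (Hsum z *m v).
Proof.
move=> z_near.
have E : dotv v (Hsum z *m v) =
    \sum_(i < m) \sum_(j in S i) (jac f (z i) *m v) j 0 ^+ 2.
  rewrite /Hsum mulmx_suml dotv_sumr; apply: eq_bigr => i _.
  rewrite mulmx_suml dotv_sumr; apply: eq_bigr => j _.
  by rewrite Hterm_mulmx dotvZr dotvC dotv_grad.
have Exs : \sum_(i < m) \sum_(j in S i) (jac f xs *m v) j 0 ^+ 2 =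
    enorm (jac f xs *m v) ^+ 2.
  by rewrite sum_batches// sqr_enorm dotvE; apply: eq_bigr => j _; rewrite expr2.
have lower : mu ^+ 2 * dotv v v <= enorm (jac f xs *m v) ^+ 2.
  by rewrite -sqr_enorm -exprMn lerXn2r ?nnegrE ?mulr_ge0 ?enorm_ge0// ltW.
have pert : enorm (jac f xs *m v) ^+ 2 - dotv v (Hsum z *m v) <=
    2 * L * Hnu * rho `^ nu * dotv v v * m%:R.
  rewrite E -Exs -sumrB mulr_natr -[m in leRHS]card_ord -sumr_const.
  apply: ler_sum => i _; apply: le_trans (block_gram_perturb L0 f_diff f_lip jac_holder _ _ _ _) _.
  rewrite sqr_enorm ler_wpM2r ?dotvv_ge0// ler_wpM2l ?mulr_ge0 ?(ltW L0) ?(ltW Hnu0)//.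
  by apply: ge0_ler_powR; rewrite ?nnegrE ?enorm_ge0 ?(ltW nu0) ?(ltW rho0).
have := ler_wpM2r (dotvv_ge0 v) rho_small; lra.
Qed.

Lemma Hsum_unit z : (forall i, enorm (z i - xs) <= rho) -> Hsum z \in unitmx.
Proof.
move=> z_near; rewrite unitmxE unitfE; apply/det0P => -[w w0 wH].
have Hw : Hsum z *m w^T = 0 by rewrite -trmx_Hsum -trmx_mul wH trmx0.
have := Hsum_coercive w^T z_near; rewrite Hw dotv0 -sqr_enorm.
apply/negP; rewrite -ltNge mulr_gt0 ?divr_gt0 ?exprn_gt0// enorm_gt0//.
by rewrite -(inj_eq trmx_inj) trmxK trmx0.
Qed.

Lemma ign_error_step z : (forall i, enorm (z i - xs) <= rho) ->
  enorm (invmx (Hsum z) *m usum z - xs) <=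
  a * \sum_(i < m) enorm (z i - xs) `^ (1 + nu).
Proof.
move=> z_near; set e := _ - xs.
have He : Hsum z *m e =
    \sum_(i < m) \sum_(j in S i) (uterm f j (z i) - Hterm f j (z i) *m xs).
  rewrite mulmxBr mulKVmx ?Hsum_unit// mulmx_suml -sumrB; apply: eq_bigr => i _.
  by rewrite mulmx_suml -sumrB.
have nHe : enorm (Hsum z *m e) <=
    L * (Hnu / (1 + nu)) * \sum_(i < m) enorm (z i - xs) `^ (1 + nu).
  rewrite He mulr_sumr; elim/big_ind2: _ => [|u1 b1 u2 b2 h1 h2|i _].
  - by rewrite enorm0.
  - exact: le_trans (enormD _ _) (lerD h1 h2).
  - exact: block_residual_le.
(* Coercivity and Cauchy-Schwarz, after division by [|e|]. *)
have low : mu ^+ 2 / 2 * enorm e <= enorm (Hsum z *m e).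
  have [->|e0] := eqVneq e 0; first by rewrite enorm0 mulr0 enorm_ge0.
  rewrite -(ler_pM2l (enorm_gt0 e0)).
  apply: le_trans (le_trans (ler_norm _) (dotv_le _ _)).
  by apply: le_trans (Hsum_coercive e z_near); rewrite -sqr_enorm expr2 mulrCA.
rewrite -(@ler_pM2l _ (mu ^+ 2 / 2)) ?divr_gt0 ?exprn_gt0//.
apply: le_trans (le_trans low nHe) _; rewrite [leRHS]mulrA.
have -> : L * (Hnu / (1 + nu)) = mu ^+ 2 / 2 * a; last by [].
by rewrite /a; field; rewrite !gt_eqF ?addr_gt0 ?exprn_gt0.
Qed.

Lemma error_coef_ge0 : 0 <= a.
Proof. by rewrite divr_ge0 ?mulr_ge0 ?addr_ge0 ?sqr_ge0// ltW. Qed.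

Lemma error_coef_small : a * m%:R * rho `^ nu <= 1 / (2 * (1 + nu)).
Proof.
have nu10 : 0 < 1 + nu by rewrite addr_gt0.
have -> : a * m%:R * rho `^ nu =
    (4 * L * Hnu * m%:R * rho `^ nu) / (mu ^+ 2 * (2 * (1 + nu))).
  by rewrite /a; field; rewrite !gt_eqF ?exprn_gt0.
have -> : 1 / (2 * (1 + nu)) = mu ^+ 2 / (mu ^+ 2 * (2 * (1 + nu))).
  by field; rewrite !gt_eqF ?exprn_gt0.
by rewrite ler_pM2r// invr_gt0 mulr_gt0 ?exprn_gt0// mulr_gt0.
Qed.

Variable r : nat -> R.
Hypothesis r0 : r 0%N = rho.
Hypothesis rS : forall t, r t.+1 = a * \sum_(s < m) r (t - s)%N `^ (1 + nu).

Lemma r_le_rho t : r t <= rho.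
Proof.
rewrite -r0; have mE := prednK m0.
apply: (@delay_noninc _ a rho nu m.-1 r) => //; rewrite ?mE//.
- exact: error_coef_ge0.
- exact: error_coef_small.
Qed.

(** The three claims need a joint induction: anchors in the ball make [Hsum] invertible, an exact
    inverse [G] gives the error bound, and that bound keeps the next anchor in the ball. Iterates
    are bounded at all times up to [t] because the window reaches back over an epoch. *)
Lemma ign_invariant t :
  [/\ forall s, (s <= t)%N -> enorm (st_x (st s) - xs) <= r s,
      forall i, enorm (st_z (st t) i - xs) <= rho &
      st_G (st t) = invmx (st_H (st t))].
Proof.
elim: t => [|t [IHx IHz IHG]].
  by split=> // s; rewrite leqn0 => /eqP ->; rewrite r0.
have xS : enorm (st_x (st t.+1) - xs) <= r t.+1.
  rewrite st_xS IHG st_HE st_uE; apply: le_trans (ign_error_step IHz) _.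
  rewrite rS ler_wpM2l ?error_coef_ge0// (sum_window (fun x => enorm (x - xs) `^ (1 + nu))).
  apply: ler_sum => s _; have h := IHx _ (leq_subr s t).
  have rs0 := le_trans (enorm_ge0 _) h; have nu10 : 0 <= 1 + nu by rewrite addr_ge0// ltW.
  by apply: ge0_ler_powR => //; rewrite nnegrE enorm_ge0.
have zS i : enorm (st_z (st t.+1) i - xs) <= rho.
  by rewrite st_zS; case: ifP => // _; exact: le_trans xS (r_le_rho _).
split=> //.
  by move=> s; rewrite leq_eqVlt ltnS => /predU1P[->|/IHx].
(* Woodbury needs the old and the new [H] invertible; for the new one this is where [zS] enters. *)
rewrite st_GS st_HS woodbury -?IHG//; first by rewrite st_HE Hsum_unit.
by rewrite -st_HS st_HE Hsum_unit.
Qed.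

End Algorithm.

(** * Assembly of the convergence theorem *)

Theorem theorem2 (R : realType) (d n k : nat) (f : 'cV[R]_d -> 'cV[R]_n)
    (Lf nu Hnu mu : R) (xs x0 : 'cV[R]_d) (S : nat -> {set 'I_n})
    (d_ge1 : (1 <= d)%N) (d_le_n : (d <= n)%N)
    (f_diff : forall x, differentiable f x)
    (Lf_gt0 : 0 < Lf)
    (f_lip : forall x y, enorm (f x - f y) <= Lf * enorm (x - y))
    (nu_gt0 : 0 < nu) (nu_le1 : nu <= 1) (Hnu_gt0 : 0 < Hnu)
    (jac_holder : forall x y,
      spectral_norm (jac f x - jac f y) <= Hnu * enorm (x - y) `^ nu)
    (f_xs : f xs = 0)
    (muE : mu = sigma_min (jac f xs)) (mu_gt0 : 0 < mu)
    (k_ge1 : (1 <= k)%N) (k_le_n : (k <= n)%N)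
    (S_part : batch_partition k S)
    (x0_near : enorm (x0 - xs) <=
      (mu ^+ 2 / (4 * k%:R * Lf * Hnu * (nbatch n k)%:R)) `^ nu^-1) :
  let m := nbatch n k in
  let st := mb_ign f k S x0 in
  let c := 1 - m%:R^-1 * (1 - (1 / (2 * (1 + nu))) `^ (1 + nu)) in
  [/\ forall t, loewner_ge (st_H (st t)) (mu ^+ 2 / 2)%:M,
      forall t, 0 < sigma_min (1%:M +
        (ign_V f k S t (st t))^T *m st_G (st t) *m ign_U f k S t (st t)) &
      exists r : nat -> R,
        (forall t, enorm (st_x (st t) - xs) <= r t) /\
        (forall t, (m <= t)%N ->
          r t.+1 <= c `^ ((1 + nu) ^+ (t %/ m - 1)) * r t)].
Proof.
move=> m st c.
have m0 : (0 < m)%N := nbatch_gt0 k_ge1 k_le_n.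
have m_gt0 : 0 < m%:R :> R by rewrite ltr0n.
have k_gt0 : 0 < k%:R :> R by rewrite ltr0n.
have nu10 : 0 < 1 + nu by rewrite addr_gt0.
set D := mu ^+ 2 / (4 * k%:R * Lf * Hnu * (nbatch n k)%:R) in x0_near.
have D0 : 0 < D by rewrite divr_gt0 ?exprn_gt0// !mulr_gt0.
pose rho := D `^ nu^-1.
have rho0 : 0 < rho by rewrite powR_gt0.
have rho_nu : rho `^ nu = D by rewrite -powRrM mulVf ?gt_eqF// powRr1// ltW.
have rho_small : 4 * Lf * Hnu * m%:R * rho `^ nu <= mu ^+ 2.
  (* The radius is chosen so that this product is exactly [mu^2 / k]. *)
  have -> : 4 * Lf * Hnu * m%:R * rho `^ nu = mu ^+ 2 / k%:R.
    by rewrite rho_nu /D -/m; field; rewrite !gt_eqF.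
  by rewrite ler_pdivrMr// ler_peMr ?sqr_ge0// ler1n.
have mu_xs v : mu * enorm v <= enorm (jac f xs *m v) by rewrite muE sigma_min_le.
pose a := 2 * Lf * Hnu / ((1 + nu) * mu ^+ 2).
have [r [r0 rS]] :=
  delay_sequence rho (fun p : nat -> R => a * \sum_(s < m) p s `^ (1 + nu)).
have inv := ign_invariant k_ge1 k_le_n S_part Lf_gt0 nu_gt0 Hnu_gt0 mu_gt0 rho0
  f_diff f_lip jac_holder f_xs mu_xs rho_small x0_near r0 rS.
have Hunit t : st_H (st t) \in unitmx.
  have [_ near _] := inv t.
  rewrite (st_HE f x0 k_ge1 k_le_n S_part).
  exact: (Hsum_unit S_part Lf_gt0 nu_gt0 Hnu_gt0 mu_gt0 rho0 f_diff f_lip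
    jac_holder mu_xs rho_small near).
split.
- move=> t; have [_ near _] := inv t.
  rewrite (st_HE f x0 k_ge1 k_le_n S_part); split.
  + exact: trmx_Hsum.
  + exact: tr_scalar_mx.
  move=> v; rewrite -mulmxA -/(dotv _ _) mulmxBl dotvBr mul_scalar_mx dotvZr subr_ge0.
  exact: (Hsum_coercive S_part Lf_gt0 nu_gt0 Hnu_gt0 mu_gt0 rho0 f_diff f_lip
    jac_holder mu_xs rho_small _ near).
(* The core has size twice that of the batch, positive since no batch is empty; it is invertible
   because [H] is at times [t] and [t + 1]. *)
- move=> t; have [_ _ G] := inv t; apply: sigma_min_unit_gt0.
    rewrite sum_nat_const card_ord muln_gt0 andbT.
    by apply: (batch_card_gt0 k_ge1 S_part); rewrite ltn_mod.
  rewrite G; apply: woodbury_core_unit.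
    exact: Hunit.
  by rewrite -st_HS; exact: (Hunit t.+1).
exists r; split; first by move=> t; have [+ _ _] := inv t; exact.
(* The delay lemmas take the window length in the form [m'.+1], so [m] is rewritten as the successor
   of its predecessor. *)
have mE := prednK m0; move=> t mt; rewrite /c -mE.
apply: (@delay_superlinear_rate _ a rho); rewrite ?mE//.
  exact: error_coef_ge0 Lf_gt0 nu_gt0 Hnu_gt0 mu_gt0.
exact: error_coef_small nu_gt0 mu_gt0 rho_small.
Qed.
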